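(* Let $N\geq 1$. The magic unitary $w=(w_{i_1\ldots i_N,k_1\ldots k_N})_{i,k\in\{0,1\}^N}$ of the embedding $\bar{O}_N\subset S_{2^N}^+$ (coming from the action of $\bar O_N$ on the $N$-hypercube) is given by $$w_{i_1\ldots i_N,k_1\ldots k_N}=\frac{1}{2^N}\sum_{j_1,\ldots,j_N\in\{0,1\}}\ \sum_{b_1,\ldots,b_N\in\{1,\ldots,N\}}(-1)^{\langle i+k_b,j\rangle}\left(\frac{1}{N}\right)^{\#(0\in j)}u_{1b_1}^{j_1}\cdots u_{Nb_N}^{j_N}$$ where $k_b=(k_{b_1},\ldots,k_{b_N})$, for multi-indices $i,k\in\{0,1\}^N$.
   Context: $\bar O_N$ is the compact quantum group whose algebra $C(\bar O_N)$ is the universal $C^*$-algebra generated by self-adjoint elements $u_{ij}$ ($1\le i,j\le N$) such that $u=(u_{ij})$ satisfies $u^t=u^{-1}$, and such that distinct entries $u_{ij},u_{kl}$ anticommute if they lie on the same row or the same column of $u$ and commute otherwise; its comultiplication is $\Delta(u_{ij})=\sum_k u_{ik}\otimes u_{kj}$. Let $g_1,\ldots,g_N$ be the standard generators of $\mathbb Z_2^N$. There is a coaction $\Phi:C^*(\mathbb Z_2^N)\to C(\bar O_N)\otimes C^*(\mathbb Z_2^N)$, $\Phi(g_i)=\sum_j u_{ij}\otimes g_j$, which is the quantum isometric action of $\bar O_N$ on the $N$-hypercube $\widehat{\mathbb Z_2^N}$ (having $2^N$ vertices). One identifies $C^*(\mathbb Z_2^N)$ with $C(\mathbb Z_2^N)$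 via the Fourier isomorphism $\beta(g_1^{i_1}\cdots g_N^{i_N})=\sum_{j\in\{0,1\}^N}(-1)^{\langle i,j\rangle}\delta_{g_1^{j_1}\cdots g_N^{j_N}}$, with inverse $\alpha=\beta^{-1}$ given by $\alpha(\delta_{g_1^{i_1}\cdots g_N^{i_N}})=2^{-N}\sum_{j\in\{0,1\}^N}(-1)^{\langle i,j\rangle}g_1^{j_1}\cdots g_N^{j_N}$, where $\langle i,j\rangle=\sum_k i_kj_k$. The magic unitary $w$ is the matrix of the resulting coaction $\Psi=(id\otimes\beta)\Phi\alpha$ on $C(\mathbb Z_2^N)$, that is, $\Psi(\delta_{g_1^{i_1}\cdots g_N^{i_N}})=\sum_{k\in\{0,1\}^N} w_{i_1\ldots i_N,k_1\ldots k_N}\otimes\delta_{g_1^{k_1}\cdots g_N^{k_N}}$. A magic unitary is a square matrix of projections summing to $1$ on each row and column; it corresponds to a quantum permutation action, here giving $\bar O_N\subset S_{2^N}^+$. $\#(0\in j)$ denotes the number of entries of $j$ equal to $0$. Conventions: $u_{ab}^0=1$, $u_{ab}^1=u_{ab}$. *)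

(* Defs.v *)
From HB Require Import structures.
From mathcomp Require Import all_boot all_order all_algebra all_fingroup.
From mathcomp Require Import complex.
From mathcomp Require Import all_reals.
Set Implicit Arguments.
Unset Strict Implicit.
Unset Printing Implicit Defensive.
Import Order.TTheory GRing.Theory Num.Theory.
Local Open Scope ring_scope.
Local Open Scope complex_scope.

(* The complex numbers are R[i], for R a realType.  All algebras are unital. *)

HB.mixin Record Algebra_isStar (R : realType) A of GRing.Algebra R[i] A := {
  star : A -> A;
  starK : involutive star;
  starD : {morph star : x y / x + y};
  starZ : forall (c : R[i]) (x : A), star (c *: x) = c^* *: star x;
  starM : forall x y : A, star (x * y) = star y * star x
}.

#[short(type="starAlgType")]
HB.structure Definition StarAlgebra (R : realType) :=
  {A of GRing.Algebra R[i] A & Algebra_isStar R A}.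

(* The norm is a field of this mixin, and completeness is spelled out with
   sequences, because Hierarchy Builder rejects a structure that inherits from
   both NormedModule and Algebra: Num.NumDomain is already a join of a norm with
   a ring, and no structure below it is. *)
HB.mixin Record StarAlgebra_isCStar (R : realType) A of StarAlgebra R A := {
  cnorm : A -> R;
  cnorm0_eq0 : forall x : A, cnorm x = 0 -> x = 0;
  cnormD : forall x y : A, cnorm (x + y) <= cnorm x + cnorm y;
  cnormZ : forall (c : R[i]) (x : A), cnorm (c *: x) = Normc.normc c * cnorm x;
  cnormM : forall x y : A, cnorm (x * y) <= cnorm x * cnorm y;
  cnorm_star : forall x : A, cnorm (star x * x) = cnorm x ^+ 2;
  cnorm_complete : forall s : nat -> A,
    (forall e : R, 0 < e -> exists n : nat, forall p q : nat,
       (n <= p)%N -> (n <= q)%N -> cnorm (s p - s q) < e) ->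
    exists l : A, forall e : R, 0 < e -> exists n : nat, forall p : nat,
       (n <= p)%N -> cnorm (s p - l) < e
}.

#[short(type="cstarAlgType")]
HB.structure Definition CStarAlgebra (R : realType) :=
  {A of StarAlgebra R A & StarAlgebra_isCStar R A}.

Definition star_preserving (R : realType) (A B : starAlgType R) (f : A -> B) :=
  {morph f : x / star x}.

Lemma complex_scalerAr (R : realType) (k x y : R[i]) :
  k *: (x * y) = x * (k *: y).
Proof. exact: mulrCA. Qed.

HB.instance Definition _ (R : realType) :=
  GRing.Lalgebra_isAlgebra.Build R[i] R[i] (@complex_scalerAr R).

Lemma complex_starM (R : realType) (x y : R[i]) : (x * y)^* = y^* * x^*.
Proof. by rewrite rmorphM mulrC. Qed.

HB.instance Definition _ (R : realType) :=
  Algebra_isStar.Build R R[i] (@conjcK R) (rmorphD (@conjc R))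
    (rmorphM (@conjc R)) (@complex_starM R).

Section ObarRelations.
Variables (R : realType) (N : nat) (A : starAlgType R) (u : 'M[A]_N).

Definition same_line (p q : 'I_N * 'I_N) := (p.1 == q.1) || (p.2 == q.2).

Definition Obar_relations : Prop :=
  [/\ forall i j, star (u i j) = u i j,
      u *m u^T = 1%:M /\ u^T *m u = 1%:M &
      forall p q : 'I_N * 'I_N, p != q ->
        u p.1 p.2 * u q.1 q.2 =
          if same_line p q then - (u q.1 q.2 * u p.1 p.2)
          else u q.1 q.2 * u p.1 p.2].

End ObarRelations.

(* A, with the generators u, is the universal C*-algebra C(\bar O_N).  It is
   characterized by its universal property, so up to unique isomorphism. *)
Definition is_C_Obar (R : realType) (N : nat)
    (A : cstarAlgType R) (u : 'M[A]_N) : Prop :=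
  Obar_relations u /\
  forall (B : cstarAlgType R) (v : 'M[B]_N), Obar_relations v ->
    exists f : {lrmorphism A -> B},
      [/\ star_preserving f, forall i j, f (u i j) = v i j &
          forall f' : {lrmorphism A -> B}, star_preserving f' ->
            (forall i j, f' (u i j) = v i j) -> f' =1 f].

(* grpalg A gT is the algebra of formal sums of the elements of a finite group
   with coefficients in A, a family x standing for \sum_g x g . g.  So
   grpalg R[i] gT is the group C*-algebra of gT, and grpalg A gT is the
   tensor product of A with it. *)
Definition grpalg (A : Type) (gT : finGroupType) : Type := {ffun gT -> A}.

Section GroupAlgebraRing.
Variables (A : nzRingType) (gT : finGroupType).
Local Notation kG := (grpalg A gT).

HB.instance Definition _ := GRing.Zmodule.copy kG {ffun gT -> A}.

Definition grpalg_elt (g : gT) : kG := [ffun h => (h == g)%:R].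
Definition grpalg_mul (x y : kG) : kG :=
  [ffun h => \sum_(g : gT) x g * y (g^-1 * h)%g].

Lemma grpalg_mulA : associative grpalg_mul.
Proof.
move=> x y z; apply/ffunP=> h; rewrite !ffunE.
transitivity (\sum_i \sum_g x i * (y (i^-1 * g)%g * z (g^-1 * h)%g)).
  apply: eq_bigr => i _; rewrite ffunE big_distrr /=.
  rewrite (reindex_inj (mulgI i^-1)%g) /=; apply: eq_bigr => g _.
  by rewrite invMg invgK !mulgA mulgK.
rewrite exchange_big; apply: eq_bigr => g _; rewrite ffunE big_distrl /=.
by apply: eq_bigr => i _; rewrite mulrA.
Qed.

Lemma grpalg_mul1l : left_id (grpalg_elt 1%g) grpalg_mul.
Proof.
move=> x; apply/ffunP=> h; rewrite ffunE (bigD1 1%g) //= big1 => [|g /negPf g1].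
  by rewrite ffunE eqxx mul1r invg1 mul1g addr0.
by rewrite ffunE g1 mul0r.
Qed.

Lemma grpalg_mul1r : right_id (grpalg_elt 1%g) grpalg_mul.
Proof.
move=> x; apply/ffunP=> h; rewrite ffunE (bigD1 h) //= big1 => [|g /negPf g1].
  by rewrite ffunE mulVg eqxx mulr1 addr0.
by rewrite ffunE -eq_mulVg1 g1 mulr0.
Qed.

Lemma grpalg_mulDl : left_distributive grpalg_mul +%R.
Proof.
move=> x y z; apply/ffunP=> h; rewrite !ffunE -big_split.
by apply: eq_bigr => g _; rewrite ffunE mulrDl.
Qed.

Lemma grpalg_mulDr : right_distributive grpalg_mul +%R.
Proof.
move=> x y z; apply/ffunP=> h; rewrite !ffunE -big_split.
by apply: eq_bigr => g _; rewrite ffunE mulrDr.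
Qed.

Lemma grpalg_oner_neq0 : grpalg_elt 1%g != 0.
Proof. by apply/eqP=> /ffunP/(_ 1%g)/eqP; rewrite !ffunE eqxx oner_eq0. Qed.

HB.instance Definition _ := GRing.Zmodule_isNzRing.Build kG
  grpalg_mulA grpalg_mul1l grpalg_mul1r grpalg_mulDl grpalg_mulDr
  grpalg_oner_neq0.

End GroupAlgebraRing.

Section GroupAlgebraStar.
Variables (R : realType) (A : starAlgType R) (gT : finGroupType).
Local Notation kG := (grpalg A gT).

HB.instance Definition _ := GRing.Lmodule.copy kG {ffun gT -> A}.

Lemma grpalg_scalerAl (c : R[i]) (x y : kG) : c *: (x * y) = (c *: x) * y.
Proof.
apply/ffunP=> h; rewrite !ffunE scaler_sumr.
by apply: eq_bigr => g _; rewrite ffunE scalerAl.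
Qed.

Lemma grpalg_scalerAr (c : R[i]) (x y : kG) : c *: (x * y) = x * (c *: y).
Proof.
apply/ffunP=> h; rewrite !ffunE scaler_sumr.
by apply: eq_bigr => g _; rewrite ffunE scalerAr.
Qed.

HB.instance Definition _ :=
  GRing.Lmodule_isLalgebra.Build R[i] kG grpalg_scalerAl.
HB.instance Definition _ :=
  GRing.Lalgebra_isAlgebra.Build R[i] kG grpalg_scalerAr.

Definition grpalg_star (x : kG) : kG := [ffun h => star (x h^-1%g)].

Lemma grpalg_starK : involutive grpalg_star.
Proof. by move=> x; apply/ffunP=> h; rewrite !ffunE invgK starK. Qed.

Lemma grpalg_starD : {morph grpalg_star : x y / x + y}.
Proof. by move=> x y; apply/ffunP=> h; rewrite !ffunE starD. Qed.

Lemma grpalg_starZ (c : R[i]) (x : kG) :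
  grpalg_star (c *: x) = c^* *: grpalg_star x.
Proof. by apply/ffunP=> h; rewrite !ffunE starZ. Qed.

Lemma grpalg_starM (x y : kG) :
  grpalg_star (x * y) = grpalg_star y * grpalg_star x.
Proof.
have star0 : star (0 : A) = 0.
  by apply: (addrI (star 0)); rewrite -starD !addr0.
apply/ffunP=> h; rewrite !ffunE (big_morph _ (@starD R A) star0).
rewrite [RHS](reindex_inj (mulgI h)) /=; apply: eq_bigr => g _.
by rewrite starM !ffunE !invMg !invgK mulKg.
Qed.

HB.instance Definition _ := Algebra_isStar.Build R kG
  grpalg_starK grpalg_starD grpalg_starZ grpalg_starM.

End GroupAlgebraStar.

(* For I finite, {ffun I -> A} is the tensor product of A with C^I; with this
   reading, {ffun gT -> A} is the tensor product of A with C(gT). *)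
Section Tensor.
Variables (R : realType) (A : starAlgType R).

Definition tens (I : finType) (a : A) (v : {ffun I -> R[i]}) : {ffun I -> A} :=
  [ffun t => v t *: a].

Definition dirac_fun (I : finType) (s : I) : {ffun I -> R[i]} :=
  [ffun t => (t == s)%:R].

(* id (x) f, for f linear *)
Definition id_tens (I J : finType)
    (f : {ffun I -> R[i]} -> {ffun J -> R[i]}) (x : {ffun I -> A}) :
  {ffun J -> A} := \sum_(s : I) tens (x s) (f (dirac_fun s)).

Lemma id_tensE (I J : finType)
    (f : {linear {ffun I -> R[i]} -> {ffun J -> R[i]}}) (a : A)
    (v : {ffun I -> R[i]}) :
  id_tens f (tens a v) = tens a (f v).
Proof.
have -> : v = \sum_s v s *: dirac_fun s.
  apply/ffunP=> t; rewrite sum_ffunE (bigD1 t) //= big1 => [|s /negPf st].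
    by rewrite !ffunE eqxx [_ *: _]mulr1 addr0.
  by rewrite !ffunE eq_sym st scaler0.
rewrite linear_sum /id_tens; apply/ffunP=> t.
rewrite !ffunE !sum_ffunE scaler_suml; apply: eq_bigr => s _.
rewrite linearZ !ffunE sum_ffunE (bigD1 s) //= big1 => [|r /negPf rs].
  by rewrite !ffunE eqxx [_ *: 1]mulr1 addr0 scalerA mulrC.
by rewrite !ffunE eq_sym rs scaler0.
Qed.

End Tensor.

Section Hypercube.
Variables (R : realType) (N : nat).

(* The group law of 'rV['Z_2]_N as a finGroupType is addition. *)
Definition Z2N : finGroupType := 'rV['Z_2]_N.

Definition gen (a : 'I_N) : Z2N := delta_mx 0 a.

Definition midx := {ffun 'I_N -> 'I_2}.

Definition gmon (i : midx) : Z2N := (\prod_(a < N) gen a ^+ i a)%g.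

Definition dot (i j : midx) : nat := (\sum_(a < N) i a * j a)%N.

Definition elt (g : Z2N) : grpalg R[i] Z2N := grpalg_elt R[i] g.

(* beta and alpha are the linear extensions of the formulas of the Fourier
   isomorphism on the bases of the g_1^{i_1}...g_N^{i_N} and of the
   delta_{g_1^{i_1}...g_N^{i_N}}. *)
Definition beta (x : grpalg R[i] Z2N) : {ffun Z2N -> R[i]} :=
  \sum_(i : midx)
    x (gmon i) *: \sum_(j : midx) (-1) ^+ dot i j *: dirac_fun R (gmon j).

Definition alpha (f : {ffun Z2N -> R[i]}) : grpalg R[i] Z2N :=
  \sum_(i : midx) f (gmon i) *:
    ((2 ^+ N)^-1 *: \sum_(j : midx) (-1) ^+ dot i j *: elt (gmon j)).

Lemma gmonE (i : midx) : gmon i = \row_a i a.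
Proof.
have genX (a : 'I_N) n : (gen a ^+ n)%g = gen a *+ n.
  by elim: n => // n IH; rewrite expgS mulrS IH.
have -> : gmon i = \sum_(a < N) gen a *+ i a.
  by rewrite /gmon; under eq_bigr do rewrite genX.
apply/rowP=> a; rewrite !mxE summxE (bigD1 a) //= big1 => [|b /negPf ba].
  by rewrite mulmxnE mxE !eqxx addr0 natr_Zp.
by rewrite mulmxnE mxE [_ == b]eq_sym ba andbF mul0rn.
Qed.

Lemma gmon_bij : bijective gmon.
Proof.
exists (fun g : Z2N => [ffun a => g 0 a]) => [i|g].
  by apply/ffunP=> a; rewrite gmonE ffunE mxE.
by rewrite gmonE; apply/rowP=> a; rewrite mxE ffunE.
Qed.

Variables (A : cstarAlgType R) (u : 'M[A]_N).

(* Phi is the coaction of \bar O_N on C^*(Z_2^N): being a unital *-homomorphism,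
   it is determined by its values on the generators. *)
Definition is_hypercube_coaction
    (Phi : {lrmorphism grpalg R[i] Z2N -> grpalg A Z2N}) : Prop :=
  star_preserving Phi /\
  forall i : 'I_N, Phi (elt (gen i)) = \sum_(j < N) tens (u i j) (elt (gen j)).

(* Psi = (id (x) beta) Phi alpha *)
Definition Psi (Phi : grpalg R[i] Z2N -> grpalg A Z2N)
    (f : {ffun Z2N -> R[i]}) : {ffun Z2N -> A} :=
  id_tens beta (Phi (alpha f)).

End Hypercube.

(* Main.v *)
From HB Require Import structures.
Require Import Defs.
From mathcomp Require Import all_boot all_order all_algebra all_fingroup.
From mathcomp Require Import complex.
From mathcomp Require Import all_reals.
Import GRing.Theory.
Local Open Scope ring_scope.
Local Open Scope complex_scope.
Set Implicit Arguments.
Unset Strict Implicit.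

(** Evaluating a function on the hypercube at the vertex [gmon k] amounts, on
    the Fourier side, to applying the character [g |-> (-1)^<g,k>] of [Z_2^N].
    Hence the coefficient [w i k] is obtained by extending that character
    [A]-linearly to [A (x) C^*(Z_2^N)] ([char_eval]) and applying it to
    [Phi (alpha delta_i)], that is, to
    [2^-N sum_j (-1)^<i,j> Phi (g_1^j_1 ... g_N^j_N)] ([char_eval_Psi],
    [alpha_dirac]).

    The extended character is multiplicative ([char_evalM]), because scalars are
    central in [A].  As [Phi] is multiplicative too and sends [g_a] to
    [sum_b u_ab (x) g_b], the monomial [g_1^j_1 ... g_N^j_N] is sent to the
    ordered product over [a] of [(sum_b (-1)^k_b u_ab)^j_a]
    ([char_eval_coaction]).  A factor with
    [j_a = 0] is [1 = sum_b 1/N], which turns every factor into a sum over [b]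
    ([expr_sum_bool]); distributing the product over these sums gives the
    formula, with one factor [1/N] for each zero of [j]. *)

(** * Characters of finite groups and group algebras *)

Lemma grpalg_eltM (A : nzRingType) (gT : finGroupType) (g h : gT) :
  grpalg_elt A g * grpalg_elt A h = grpalg_elt A (g * h)%g.
Proof.
apply/ffunP=> t; rewrite !ffunE (bigD1 g) //= big1 => [|s /negPf sg].
  by rewrite !ffunE eqxx mul1r addr0 -(inj_eq (mulgI g)) mulKVg.
by rewrite ffunE sg mul0r.
Qed.

Lemma grpalg_eltX (A : nzRingType) (gT : finGroupType) (g : gT) n :
  grpalg_elt A (g ^+ n)%g = grpalg_elt A g ^+ n.
Proof. by elim: n => // n IH; rewrite expgS exprS -IH grpalg_eltM. Qed.

Lemma grpalg_elt_prod (A : nzRingType) (gT : finGroupType) (I : Type)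
    (r : seq I) (g : I -> gT) :
  grpalg_elt A (\prod_(a <- r) g a)%g = \prod_(a <- r) grpalg_elt A (g a).
Proof. by apply: big_morph => // x y; rewrite grpalg_eltM. Qed.

Section CharEval.
Variables (R : realType) (A : starAlgType R) (gT : finGroupType).
Variable chi : gT -> R[i].

(** The map [id (x) chi] from [A (x) C^*(gT)] to [A]. *)
Definition char_eval (x : grpalg A gT) : A := \sum_g chi g *: x g.

Lemma char_eval_is_linear : linear char_eval.
Proof.
move=> c x y; rewrite /char_eval scaler_sumr -big_split /=.
by apply: eq_bigr => g _; rewrite !ffunE scalerDr !scalerA mulrC.
Qed.

HB.instance Definition _ :=
  GRing.isLinear.Build R[i] (grpalg A gT) A _ char_eval char_eval_is_linear.

Lemma char_eval_tens (a : A) (g : gT) :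
  char_eval (tens a (grpalg_elt R[i] g)) = chi g *: a.
Proof.
rewrite /char_eval (bigD1 g) //= big1 => [|s /negPf sg].
  by rewrite !ffunE eqxx scale1r addr0.
by rewrite !ffunE sg scale0r scaler0.
Qed.

Hypothesis chi1 : chi 1%g = 1.
Hypothesis chiM : {morph chi : g h / (g * h)%g >-> g * h}.

Lemma char_eval1 : char_eval 1 = 1.
Proof.
rewrite /char_eval (bigD1 1%g) //= big1 => [|s /negPf sg].
  by rewrite !ffunE eqxx chi1 scale1r addr0.
by rewrite !ffunE sg scaler0.
Qed.

(** Reindexing the convolution by [(g, h) |-> (g, g^-1 h)] splits the double
    sum as a product, because [chi h = chi g * chi (g^-1 h)] is a scalar and
    moves freely past the coefficients. *)
Lemma char_evalM : {morph char_eval : x y / x * y}.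
Proof.
move=> x y; rewrite /char_eval.
transitivity (\sum_h \sum_g chi h *: (x g * y (g^-1 * h)%g)).
  by apply: eq_bigr => h _; rewrite ffunE scaler_sumr.
rewrite exchange_big big_distrl; apply: eq_bigr => g _ /=.
rewrite (reindex_inj (mulgI g)) big_distrr; apply: eq_bigr => h _ /=.
by rewrite mulKg chiM -scalerAl -scalerAr scalerA.
Qed.

Lemma char_evalX (x : grpalg A gT) n : char_eval (x ^+ n) = char_eval x ^+ n.
Proof.
by elim: n => [|n IH]; rewrite ?expr0 ?char_eval1 // !exprS char_evalM IH.
Qed.

Lemma char_eval_prod (I : Type) (r : seq I) (F : I -> grpalg A gT) :
  char_eval (\prod_(a <- r) F a) = \prod_(a <- r) char_eval (F a).
Proof. exact: (big_morph _ char_evalM char_eval1). Qed.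

End CharEval.

(** * The Fourier transform of the hypercube *)

Section Fourier.
Variables (R : realType) (N : nat).
Implicit Types (i j k : midx N) (g h : Z2N N).

Lemma gmon_inj : injective (@gmon N).
Proof. exact: bij_inj (gmon_bij N). Qed.

Lemma alpha_dirac i :
  alpha (dirac_fun R (gmon i)) =
  (2 ^+ N)^-1 *: \sum_j (-1) ^+ dot i j *: elt R (gmon j).
Proof.
rewrite /alpha (bigD1 i) //= [X in _ + X]big1 => [|s /negPf si].
  by rewrite ffunE eqxx scale1r addr0.
by rewrite ffunE (inj_eq gmon_inj) si scale0r.
Qed.

Definition cube_char k g : R[i] := \prod_(a < N) (-1) ^+ (g 0%R a * k a)%N.

(** The bridge between the two sides of the Fourier isomorphism: evaluation at a
    vertex is a character, hence multiplicative for the convolution product. *)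
Lemma beta_dirac g k : beta (dirac_fun R g) (gmon k) = cube_char k g.
Proof.
have [gmonV _ gmonVK] := gmon_bij N; rewrite -[g]gmonVK.
move: (gmonV g) => i.
rewrite /beta (bigD1 i) //= [X in _ + X]big1 => [|s /negPf si]; last first.
  by rewrite ffunE (inj_eq gmon_inj) si scale0r.
rewrite [dirac_fun R _ _]ffunE eqxx scale1r addr0 sum_ffunE (bigD1 k) //=.
rewrite big1 => [|s /negPf sk].
  rewrite !ffunE eqxx [_ *: _]mulr1 addr0 /dot /cube_char.
  rewrite (big_morph _ (exprD (-1)) (expr0 _)).
  by apply: eq_bigr => a _; rewrite gmonE mxE.
by rewrite !ffunE (inj_eq gmon_inj) eq_sym sk scaler0.
Qed.

Lemma cube_char1 k : cube_char k 1%g = 1.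
Proof. by rewrite /cube_char big1 // => a _; rewrite mxE mul0n. Qed.

Lemma cube_charM k : {morph cube_char k : g h / (g * h)%g >-> g * h}.
Proof.
move=> g h; rewrite /cube_char -big_split; apply: eq_bigr => a _ /=.
rewrite mxE -exprD -mulnDl !exprM; congr (_ ^+ _).
(* the addition of ['Z_2] is that of naturals modulo 2, which (-1)^n respects *)
by rewrite /= modn2 signr_odd.
Qed.

Lemma cube_char_gen k (b : 'I_N) : cube_char k (gen b) = (-1) ^+ k b.
Proof.
rewrite /cube_char (bigD1 b) //= big1 => [|a /negPf ab].
  by rewrite mxE !eqxx mul1n mulr1.
by rewrite mxE ab andbF mul0n.
Qed.

Variables (A : cstarAlgType R) (u : 'M[A]_N).
Variable Phi : {lrmorphism grpalg R[i] (Z2N N) -> grpalg A (Z2N N)}.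

Lemma char_eval_Psi (f : {ffun Z2N N -> R[i]}) k :
  Psi Phi f (gmon k) = char_eval (cube_char k) (Phi (alpha f)).
Proof.
rewrite /Psi /id_tens sum_ffunE; apply: eq_bigr => s _.
by rewrite ffunE beta_dirac.
Qed.

Hypothesis Phi_coaction : is_hypercube_coaction u Phi.

(** Both [Phi] and the extended character are multiplicative, so their composite
    is determined on monomials by its values on the generators. *)
Lemma char_eval_coaction j k :
  char_eval (cube_char k) (Phi (elt R (gmon j))) =
  \prod_(a < N) (\sum_(b < N) (-1) ^+ k b *: u a b) ^+ j a.
Proof.
have [c1 cM] := (cube_char1 k, cube_charM k).
rewrite /elt /gmon grpalg_elt_prod rmorph_prod char_eval_prod //.
apply: eq_bigr => a _; rewrite grpalg_eltX rmorphXn char_evalX //.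
rewrite /= -/(elt R (gen a)) (proj2 Phi_coaction) linear_sum; congr (_ ^+ _).
by apply: eq_bigr => b _ /=; rewrite /elt char_eval_tens cube_char_gen.
Qed.

End Fourier.

(** * The magic unitary *)

(** For [m = 0] the left side is [1], written as an average over ['I_N] so as
    to have the same shape as for [m = 1].  The index [a] serves to exclude
    [N = 0]. *)
Lemma expr_sum_bool (R : realType) (A : starAlgType R) (N : nat) (a : 'I_N)
    (c : 'I_N -> nat) (x : 'I_N -> A) (m : 'I_2) :
  (\sum_(b < N) (-1) ^+ c b *: x b) ^+ m =
  \sum_(b < N) ((-1) ^+ (c b * m)%N * N%:R^-1 ^+ (m == 0%N :> nat)) *:
    x b ^+ m.
Proof.
have N_neq0 : N%:R != 0 :> R[i].
  by rewrite Num.Theory.pnatr_eq0 -lt0n (leq_ltn_trans _ (ltn_ord a)).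
case: m => [[|[|//]] m_lt2] /=; last first.
  by rewrite expr1; apply: eq_bigr => b _; rewrite muln1 mulr1 expr1.
under [RHS]eq_bigr do rewrite muln0 mul1r !expr0.
by rewrite expr0 sumr_const card_ord -scaler_nat scalerA mulfV ?scale1r.
Qed.

Lemma prodr_scale (K : comNzRingType) (A : algType K) (I : Type) (r : seq I)
    (c : I -> K) (x : I -> A) :
  \prod_(a <- r) (c a *: x a) = (\prod_(a <- r) c a) *: \prod_(a <- r) x a.
Proof.
elim: r => [|a r IH]; first by rewrite !big_nil scale1r.
by rewrite !big_cons IH -scalerAl -scalerAr scalerA.
Qed.

Unset Implicit Arguments.

Theorem proposition3p2 (R : realType) (N : nat) (N_ge1 : (1 <= N)%N)
    (A : cstarAlgType R) (u : 'M[A]_N) (A_univ : is_C_Obar u)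
    (Phi : {lrmorphism grpalg R[i] (Z2N N) -> grpalg A (Z2N N)})
    (Phi_coaction : is_hypercube_coaction u Phi)
    (w : midx N -> midx N -> A)
    (w_def : forall i : midx N,
       Psi Phi (dirac_fun R (gmon i)) =
       \sum_(k : midx N) tens (w i k) (dirac_fun R (gmon k)))
    (i k : midx N) :
  w i k =
    (2 ^+ N)^-1 *:
    \sum_(j : midx N) \sum_(b : {ffun 'I_N -> 'I_N})
      ((-1) ^+ (\sum_(a < N) (i a + k (b a)) * j a)%N
       * (N%:R^-1) ^+ #|[set a | j a == 0%N :> nat]|) *:
      \prod_(a < N) u a (b a) ^+ j a.
Proof.
have -> : w i k = Psi Phi (dirac_fun R (gmon i)) (gmon k).
  rewrite w_def sum_ffunE (bigD1 k) //= big1 => [|s /negPf sk].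
    by rewrite !ffunE eqxx scale1r addr0.
  by rewrite !ffunE (inj_eq (@gmon_inj N)) eq_sym sk scale0r.
rewrite char_eval_Psi alpha_dirac !linearZ; congr (_ *: _).
rewrite !linear_sum; apply: eq_bigr => j _ /=.
rewrite !linearZ /= (char_eval_coaction Phi_coaction).
under [X in _ *: X]eq_bigr => a _ do rewrite (expr_sum_bool a).
rewrite bigA_distr_bigA scaler_sumr; apply: eq_bigr => b _ /=.
rewrite prodr_scale scalerA big_split mulrA /=; congr (_ * _ *: _).
  rewrite -(big_morph _ (exprD (-1)) (expr0 _)) -exprD; congr (_ ^+ _).
  by rewrite -big_split; apply: eq_bigr => a _; rewrite mulnDl.
rewrite -(big_morph _ (exprD N%:R^-1) (expr0 _)) -sum1dep_card.
by rewrite [in RHS]big_mkcond; congr (_ ^+ _); apply: eq_bigr => a _; case: eqP.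
Qed.
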